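(* Let $f\in 2^{[m]*}$ be nice and such that $K_f=\mathrm{supp}(f)$ is an abstract simplicial complex on vertex set $[m]$. Then there exists some $a\in\mathrm{supp}(f)$ such that $$|\mathrm{supp}(\mathcal{M}(f))|\geq 2^{m-|a|}.$$
   Context: Let $m$ be a positive integer, $[m]=\{1,\dots,m\}$, and $2^{[m]}$ the power set of $[m]$. $2^{[m]*}$ is the set of all functions $f:2^{[m]}\to\mathbb{Z}/2\mathbb{Z}=\{0,1\}$. The support is $\mathrm{supp}(f)=f^{-1}(1)\subseteq 2^{[m]}$. An abstract simplicial complex is a collection of subsets closed under taking subsets (including the empty set); it is on vertex set $[m]$ if the union of its members is $[m]$. $f$ is nice if $\mathrm{supp}(f)$ is an abstract simplicial complex. The $\mathbb{Z}/2\mathbb{Z}$-valued Möbius transform $\mathcal{M}:2^{[m]*}\to 2^{[m]*}$ is $\mathcal{M}(f)(a)=\sum_{b\subseteq a}f(b)$. *)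

(* Defs.v *)
From mathcomp Require Import all_boot all_order all_algebra.

Set Implicit Arguments.
Unset Strict Implicit.
Unset Printing Implicit Defensive.

Import GRing.Theory.
Local Open Scope ring_scope.

(* The vertex set [m] = {1, .., m} is represented by 'I_m = {0, .., m-1}. *)
Definition boolfun (m : nat) := {ffun {set 'I_m} -> 'F_2}.

Definition supp (m : nat) (f : boolfun m) : {set {set 'I_m}} :=
  [set a | f a == 1].

Definition simplicial_complex (m : nat) (K : {set {set 'I_m}}) : Prop :=
  set0 \in K /\ forall a b : {set 'I_m}, a \in K -> b \subset a -> b \in K.

Definition on_full_vertex_set (m : nat) (K : {set {set 'I_m}}) : Prop :=
  cover K = [set: 'I_m].

Definition nice (m : nat) (f : boolfun m) : Prop := simplicial_complex (supp f).

Definition mobius (m : nat) (f : boolfun m) : boolfun m :=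
  [ffun a : {set 'I_m} => \sum_(b : {set 'I_m} | b \subset a) f b].

(* Main.v *)
Require Import Defs.
From mathcomp Require Import all_boot all_order all_algebra.

(** Read [f] as the coefficients of a multilinear polynomial over F_2, so that
    [mobius f] is its table of values at 0/1 points. Let [a] be an
    inclusion-maximal monomial. For each [c] disjoint from [a], summing the
    values over the subcube of points [c :|: b] with [b \subset a] leaves only
    the coefficients of monomials containing [a], i.e. [f a = 1]. Hence each of
    the [2 ^ (m - #|a|)] disjoint subcubes contains a point of the support. *)

Import GRing.Theory.
Local Open Scope ring_scope.

Lemma card_set_between (T : finType) (A B : {set T}) :
  A \subset B -> #|[set X : {set T} | A \subset X & X \subset B]| = (2 ^ #|B :\: A|)%N.
Proof.
move=> sAB; rewrite -card_powerset.
have -> : [set X : {set T} | A \subset X & X \subset B]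
    = [set A :|: Y | Y in powerset (B :\: A)].
  apply/setP => X; rewrite inE; apply/andP/imsetP => [[sAX sXB]|[Y]].
    by exists (X :\: A); rewrite ?powersetE ?setSD // setDE setUIr setUCr setIT (setUidPr sAX).
  by rewrite powersetE subsetD => /andP[sYB _] ->; rewrite subsetUl subUset sAB.
apply: card_in_imset => X Y; rewrite !powersetE !subsetD.
move=> /andP[_ dXA] /andP[_ dYA] /(congr1 (fun Z => Z :\: A)).
by rewrite !setDUl setDv !set0U (setDidPl dXA) (setDidPl dYA).
Qed.

Lemma F2_eq0 (x : 'F_2) : x != 1 -> x = 0.
Proof. by case: x => [[|[|n]] hx] // _; apply/val_inj. Qed.

Lemma F2_mulrn_even (x : 'F_2) (n : nat) : ~~ odd n -> x *+ n = 0.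
Proof.
move=> /even_halfK <-; rewrite -mul2n mulrnA.
by rewrite (_ : x *+ 2 = 0) ?mul0rn // -mulr_natr pchar_Zp ?mulr0.
Qed.

(** After exchanging the sums, [f d] is counted once for each [b] with
    [d :&: a \subset b \subset a], that is [2 ^ #|a :\: d|] times. Modulo 2 this vanishes unless
    [a \subset d]. *)
Lemma sum_mobius_subcube {m : nat} (f : boolfun m) (a c : {set 'I_m}) :
  [disjoint c & a] ->
  \sum_(b : {set 'I_m} | b \subset a) mobius f (c :|: b)
  = \sum_(d : {set 'I_m} | (a \subset d) && (d \subset c :|: a)) f d.
Proof.
move=> dca.
under eq_bigr => b _ do rewrite ffunE.
rewrite (exchange_big_dep (fun d : {set 'I_m} => d \subset c :|: a)) /=; last first.
  by move=> b d sba /subset_trans; apply; apply: setUS.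
rewrite [RHS]big_mkcondl; apply: eq_bigr => d sdca.
(* Since [c] misses [a], the part of [d] inside [a] can only be covered by [b]; the rest of [d]
   already lies in [c]. *)
have cover_eq (b : {set 'I_m}) :
    (b \subset a) && (d \subset c :|: b) = (d :&: a \subset b) && (b \subset a).
  rewrite andbC; case sba: (b \subset a); rewrite ?andbF // !andbT.
  apply/idP/idP => [sdcb|sdab].
    apply/subsetP => x /setIP[xd xa]; have := subsetP sdcb x xd.
    by rewrite inE => /orP[xc|//]; have := disjointFr dca xc; rewrite xa.
  apply/subsetP => x xd; have := subsetP sdca x xd.
  rewrite !inE => /orP[->//|xa].
  by rewrite (subsetP sdab) ?orbT // inE xd.
rewrite (eq_bigl (mem [set b : {set 'I_m} | d :&: a \subset b & b \subset a])); last first.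
  by move=> b; rewrite cover_eq !inE.
rewrite sumr_const card_set_between ?subsetIr // setDIr setDv setU0.
case: ifPn => [|nsad]; first by rewrite -setD_eq0 => /eqP ->; rewrite cards0.
by apply: F2_mulrn_even; rewrite oddX orbF cards_eq0 setD_eq0.
Qed.

Lemma mobius_supp_subcube {m : nat} {f : boolfun m} {a : {set 'I_m}} (c : {set 'I_m}) :
  maxset (mem (supp f)) a -> [disjoint c & a] ->
  exists2 b : {set 'I_m}, b \subset a & c :|: b \in supp (mobius f).
Proof.
move=> /maxsetP[/= fa amax] dca; apply/exists_inP/negP => /exists_inP nex.
have := sum_mobius_subcube f a c dca.
rewrite big1 => [|b sba]; last first.
  by apply: F2_eq0; apply/negP => fb; apply: nex; exists b; rewrite ?inE.
(* Only the term [d = a] survives: by maximality, [f] vanishes at every strictly larger [d]. *)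
rewrite (bigD1 a) ?subxx ?subsetUr //= big1 => [|d /andP[/andP[sad _] nda]].
  by move: fa; rewrite inE addr0 => /eqP ->.
apply: F2_eq0; apply: contraNneq nda => fd.
by apply/eqP; apply: amax; rewrite // inE fd.
Qed.

Lemma card_mobius_supp {m : nat} {f : boolfun m} {a : {set 'I_m}} :
  maxset (mem (supp f)) a -> (2 ^ (m - #|a|) <= #|supp (mobius f)|)%N.
Proof.
move=> amax; rewrite -[X in (X - _)%N]card_ord -cardsT -cardsDS ?subsetT // setTD -card_powerset.
(* The map [x :\: a] sends each point [c :|: b] of a subcube to its label [c], so the image of the
   support contains every [c] disjoint from [a]. *)
apply: leq_trans (leq_imset_card (fun x => x :\: a) _).
apply/subset_leq_card/subsetP => c; rewrite powersetE -disjoints_subset => dca.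
have [b sba cb] := mobius_supp_subcube c amax dca.
apply/imsetP; exists (c :|: b) => //.
by rewrite setDUl (setDidPl dca); move: sba; rewrite -setD_eq0 => /eqP ->; rewrite setU0.
Qed.

Theorem theorem1p2 (m : nat) (hm : (0 < m)%N) (f : boolfun m)
    (hf : nice f) (hK : on_full_vertex_set (supp f)) :
  exists a : {set 'I_m},
    a \in supp f /\ (2 ^ (m - #|a|) <= #|supp (mobius f)|)%N.
Proof.
have [f0 _] := hf.
(* The empty set belongs to the complex, so some maximal face lies above it. *)
have [a amax _] := maxset_exists (P := mem (supp f)) f0.
by exists a; split; [exact: (maxsetp amax) | exact: card_mobius_supp].
Qed.
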